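(* Let $\Psi$ be a bialgebra endomorphism of ${\cal H}_R$. Then there exists a unique family $(P_t)_{t\in CT}$ of primitive elements of ${\cal H}_R$ such that $\Psi=\Phi_{(P_t)}$.
   Context: ${\cal H}_R$ is the commutative polynomial algebra over $\mathbb{Q}$ on the set $CT$ of isomorphism classes of rooted trees (finite connected simply connected graphs with a root, edges oriented away from the root; weight = number of vertices); monomials are forests. It is a bialgebra with coproduct the algebra morphism $\Delta(t)=1\otimes t+t\otimes1+\sum_CP^C(t)\otimes R^C(t)$, the sum over admissible cuts $C$ of $t$ (nonempty sets of edges meeting each root-to-vertex path at most once; after removing them, $R^C(t)$ is the component containing the root and $P^C(t)$ the product of the others), and counit $\varepsilon(1)=1$, $\varepsilon(t)=0$. Primitive: $\Delta(x)=x\otimes1+1\otimes x$. $l_1$ is the one-vertex tree. For forests $M,N$: $M\top N=0$ if $N=1$, else $\frac{1}{weight(N)}\sum_vN_v$, $v$ over vertices of $N$, $N_v$ obtained from $N$ by attaching every tree of $M$ to $v$; bilinear extension. For a family $(P_t)_{t\in CT}$ of primitive elements, $\Phi_{(P_t)}$ is the algebra endomorphism of ${\cal H}_R$ defined by induction on the weight of trees by $\Phi_{(P_t)}(l_1)=P_{l_1}$ and, for $T\in CT$, $\Phi_{(P_t)}(T)=\sum_{C}\Phi_{(P_t)}(P^C(T))\top P_{R^C(T)}+P_T$, the sum over admissible cuts $C$ of $T$ (it is a bialgebra endomorphism). *)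

(* Defs.v *)
From HB Require Import structures.
From mathcomp Require Import all_boot all_order all_algebra.
From mathcomp Require Import generic_quotient.
From mathcomp Require Import finmap.
From mathcomp.multinomials Require Import monalg.

Set Implicit Arguments.
Unset Strict Implicit.
Unset Printing Implicit Defensive.

Import GRing.Theory.
Local Open Scope ring_scope.
Local Open Scope quotient_scope.

Inductive tree : Type := Node of seq tree.

Definition children (t : tree) : seq tree := let: Node s := t in s.

Fixpoint all_tree (P : tree -> Prop) (s : seq tree) : Prop :=
  match s with [::] => True | t :: s' => P t /\ all_tree P s' end.

Lemma tree_ind' (P : tree -> Prop) :
  (forall s, all_tree P s -> P (Node s)) -> forall t, P t.
Proof.
move=> H; fix IH 1; case=> s; apply: H.
elim: s => [|t s IHs] /=; first by [].
split; [exact: IH | exact: IHs].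
Qed.

Fixpoint enc_tree (t : tree) : GenTree.tree unit :=
  let: Node s := t in GenTree.Node 0 (map enc_tree s).
Fixpoint dec_tree (g : GenTree.tree unit) : tree :=
  match g with
  | GenTree.Leaf _ => Node [::]
  | GenTree.Node _ s => Node (map dec_tree s)
  end.
Lemma enc_treeK : cancel enc_tree dec_tree.
Proof.
elim/tree_ind' => s IH /=; congr Node; rewrite -map_comp.
elim: s IH => [|t s IHs] //= [-> /IHs ->] //.
Qed.
HB.instance Definition _ := Countable.copy tree (can_type enc_treeK).

Fixpoint weight (t : tree) : nat :=
  let: Node s := t in (sumn (map weight s)).+1.

Definition tle (a b : tree) : bool := leq (choice.pickle a) (choice.pickle b).
Fixpoint canon (t : tree) : tree :=
  let: Node s := t in Node (sort tle (map canon s)).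

(* Isomorphism of rooted trees (root-preserving graph isomorphism):
   equality of canonical forms, i.e. equality up to permutation of the
   children at every vertex.                                            *)
Definition tree_iso (a b : tree) : bool := canon a == canon b.
Lemma tree_iso_refl : reflexive tree_iso. Proof. by move=> ?; rewrite /tree_iso. Qed.
Lemma tree_iso_sym : symmetric tree_iso. Proof. by move=> ??; rewrite /tree_iso eq_sym. Qed.
Lemma tree_iso_trans : transitive tree_iso.
Proof. move=> ??? /eqP E1 /eqP E2; by rewrite /tree_iso E1 E2. Qed.
Canonical tree_iso_equiv := EquivRel tree_iso tree_iso_refl tree_iso_sym tree_iso_trans.

Definition CT := {eq_quot tree_iso}.
Definition cl (t : tree) : CT := \pi_CT t.

(* H_R = Q[CT]: monomials are forests (finitely supported multisets).  *)
(* H_R (x) H_R is modelled as Q[CT + CT] (inl = left factor,           *)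
(* inr = right factor), i.e. Q[X] (x) Q[Y] = Q[X u Y].                 *)
Definition forest := {cmonom CT}.
Definition HR := {malg rat[forest]}.
Definition HR2 := {malg rat[{cmonom (CT + CT)%type}]}.

Definition X (T : CT) : HR := << ucm T >>.
Definition X2 (v : (CT + CT)%type) : HR2 := << ucm v >>.

Definition alg_ext (A : lalgType rat) (h : CT -> A) (g : HR) : A :=
  \sum_(m <- msupp g) g@_m *: \prod_(i <- finsupp m) h i ^+ m i.

Definition tens (a b : HR) : HR2 :=
  alg_ext (fun T => X2 (inl T)) a * alg_ext (fun T => X2 (inr T)) b.

Definition mleft (m : {cmonom (CT + CT)%type}) : HR :=
  \prod_(v <- finsupp m) match v with inl T => X T ^+ m v | inr _ => 1 end.
Definition mright (m : {cmonom (CT + CT)%type}) : HR :=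
  \prod_(v <- finsupp m) match v with inr T => X T ^+ m v | inl _ => 1 end.

Definition tens_map (f g : HR -> HR) (x : HR2) : HR2 :=
  \sum_(m <- msupp x) x@_m *: tens (f (mleft m)) (g (mright m)).

Definition forest_poly (l : seq tree) : HR := \prod_(u <- l) X (cl u).

Definition forest_list (m : forest) : seq tree :=
  flatten [seq nseq (m T) (repr T) | T <- finsupp m].

(* Cuts.  [cuts t] enumerates all sets C of edges of t meeting every    *)
(* root-to-vertex path at most once (including C = empty), as pairs     *)
(* (list of the pruned trees = P^C(t), trunk R^C(t)).  C is nonempty    *)
(* iff the pruned part is nonempty.                                     *)
Fixpoint cuts (t : tree) : seq (seq tree * tree) :=
  let: Node s := t in
  let fix go (s : seq tree) : seq (seq tree * seq tree) :=
    match s with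
    | [::] => [:: ([::], [::])]
    | c :: s' =>
      let rest := go s' in
      (* the edge from the root to c is cut *)
      [seq (c :: pr.1, pr.2) | pr <- rest] ++
      (* the edge is not cut: admissible (possibly empty) cut inside c *)
      [seq (q.1 ++ pr.1, q.2 :: pr.2) | q <- cuts c, pr <- rest]
    end in
  [seq (pr.1, Node pr.2) | pr <- go s].

Definition adm_cuts (T : CT) : seq (seq tree * tree) :=
  [seq c <- cuts (repr T) | c.1 != [::]].

Definition Delta_gen (T : CT) : HR2 :=
  tens 1 (X T) + tens (X T) 1 +
  \sum_(c <- adm_cuts T) tens (forest_poly c.1) (X (cl c.2)).

Definition Delta (x : HR) : HR2 := alg_ext Delta_gen x.

Definition counit (x : HR) : rat := mcoeff (onecm CT) x.

Definition primitive (x : HR) : Prop := Delta x = tens x 1 + tens 1 x.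

Definition bialg_endo (Psi : {lrmorphism HR -> HR}) : Prop :=
  (forall x, Delta (Psi x) = tens_map Psi Psi (Delta x)) /\
  (forall x, counit (Psi x) = counit x).

(* all the trees obtained from t by attaching every tree of ms to one
   vertex v, v ranging over the vertices of t *)
Fixpoint graft_at (ms : seq tree) (t : tree) : seq tree :=
  let: Node s := t in
  let fix go (pre s : seq tree) : seq tree :=
    match s with
    | [::] => [::]
    | c :: s' => [seq Node (pre ++ r :: s') | r <- graft_at ms c] ++ go (rcons pre c) s'
    end in
  Node (s ++ ms) :: go [::] s.

Definition top_mono (M N : forest) : HR :=
  let ml := forest_list M in
  let nl := forest_list N in
  if nl is [::] then 0 else
  ((sumn (map weight nl))%:R)^-1 *:
    \sum_(j < size nl) \sum_(r <- graft_at ml (nth (Node [::]) nl j))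
        forest_poly (set_nth (Node [::]) nl j r).

Definition top (a b : HR) : HR :=
  \sum_(m <- msupp a) \sum_(n <- msupp b) (a@_m * b@_n) *: top_mono m n.

Fixpoint Phi_fuel (P : CT -> HR) (n : nat) (t : tree) : HR :=
  match n with
  | 0 => 0
  | n'.+1 =>
      \sum_(c <- cuts t | c.1 != [::])
         top (\prod_(u <- c.1) Phi_fuel P n' u) (P (cl c.2))
      + P (cl t)
  end.

Definition Phi_tree (P : CT -> HR) (T : CT) : HR :=
  Phi_fuel P (weight (repr T)) (repr T).

Definition Phi (P : CT -> HR) (x : HR) : HR := alg_ext (Phi_tree P) x.

(* Main.v *)
Require Import Defs.
From HB Require Import structures.
From mathcomp Require Import all_boot all_order all_algebra.
From mathcomp Require Import generic_quotient finmap.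
From mathcomp.multinomials Require Import monalg.

Set Implicit Arguments.
Unset Strict Implicit.
Unset Printing Implicit Defensive.

Import GRing.Theory.
Local Open Scope ring_scope.
Local Open Scope quotient_scope.

(** Grafting onto a primitive element p is a 1-cocycle:
    Delta (x T p) = (x T p) (x) 1 + (id (x) (- T p)) (Delta x).
    Indeed a cut of a grafted forest either prunes the vertex that carries the
    grafted trees, together with these trees, or keeps that vertex and cuts the
    grafted trees independently; the weights in the denominator only rescale the
    homogeneous components of p, which stay primitive.  The equation
    Psi = Phi_(P) determines P_t by induction on the weight as
    P_t = Psi t - \sum_(C <> 0) Psi (P^C t) T P_(R^C t), whence uniqueness.
    Expanding Delta (P_t) by the cocycle identity and regrouping pairs of nested
    cuts by coassociativity, all terms but P_t (x) 1 + 1 (x) P_t cancel. *)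

(** Two obstacles shape the proof. Cuts and grafts of classes are computed on the representatives
    [repr T] and [forest_list m], whereas the inductions run through arbitrary lists of trees; hence
    sums over cuts and over grafts must be shown to depend on monomials only. Moreover Phi sums over
    nonempty cuts, while coassociativity regroups sums over all cuts. The gap is closed by 1 T p = p
    for p primitive: such a p has no constant term, and attaching nothing at each of the n vertices
    of a forest cancels the factor 1/n. So a primitive P_t is the missing term of the empty cut, and
    Psi t becomes a sum over all cuts of t. For the tree under study, where primitivity is still to
    be proved, the term of two empty cuts stands on both sides of coassociativity and cancels. *)

(** * Isomorphism of trees and forests *)

Lemma tree_mem_ind (P : tree -> Prop) :
  (forall s, (forall u, u \in s -> P u) -> P (Node s)) -> forall t, P t.
Proof.
move=> H; elim/tree_ind' => s IH; apply: H.
elim: s IH => [|t s IHs] //= [Pt /IHs Ps] u; rewrite inE => /orP[/eqP->//|].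
exact: Ps.
Qed.

Lemma tle_total : total tle.
Proof. by move=> a b; apply: leq_total. Qed.

Lemma tle_trans : transitive tle.
Proof. by move=> b a c; apply: leq_trans. Qed.

Lemma tle_anti : antisymmetric tle.
Proof. by move=> a b; rewrite /tle -eqn_leq => /eqP/(pcan_inj choice.pickleK). Qed.

Lemma canon_Node s s' :
  canon (Node s) = canon (Node s') <-> perm_eq (map canon s) (map canon s').
Proof.
split=> [[E]|/(perm_sortP tle_total tle_trans tle_anti) /= -> //].
by apply/(perm_sortP tle_total tle_trans tle_anti).
Qed.

Lemma clP a b : cl a = cl b <-> canon a = canon b.
Proof.
split=> [/eqP|E]; first by rewrite /cl eqquotE /= => /eqP.
by apply/eqP; rewrite /cl eqquotE /=; apply/eqP.
Qed.

Lemma canon_repr t : canon (repr (cl t)) = canon t.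
Proof. by apply/clP; rewrite /cl reprK. Qed.

Lemma cl_repr T : cl (repr T) = T.
Proof. exact: reprK. Qed.

Lemma canon_idem t : canon (canon t) = canon t.
Proof.
elim/tree_mem_ind: t => s IH; apply/canon_Node.
rewrite (permPl (perm_map _ (permEl (perm_sort tle _)))).
suff -> : map canon (map canon s) = map canon s by [].
by rewrite -map_comp; apply/eq_in_map => u us; apply: IH.
Qed.

Lemma cl_canon t : cl (canon t) = cl t.
Proof. exact/clP/canon_idem. Qed.

Lemma cl_Node s s' : perm_eq (map cl s) (map cl s') -> cl (Node s) = cl (Node s').
Proof.
move=> E; apply/clP/canon_Node.
have canonE l : map canon l = map (canon \o repr) (map cl l).
  by rewrite -map_comp; apply: eq_map => u /=; rewrite canon_repr.
by rewrite !canonE perm_map.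
Qed.

Fixpoint mon (s : seq tree) : forest :=
  if s is u :: s' then mulcm (ucm (cl u)) (mon s') else onecm CT.

Lemma monE s T : mon s T = count_mem T (map cl s).
Proof. by elim: s => [|u s IH] /=; rewrite ?onecmE // mulcmE ucmE IH. Qed.

Lemma monP s s' : mon s = mon s' <-> perm_eq (map cl s) (map cl s').
Proof.
split=> [E|/permP E]; first by apply/allP => T _ /=; rewrite -!monE E.
by apply/eqP/cmP => T; rewrite !monE E.
Qed.

Lemma mon_cat s s' : mon (s ++ s') = mulcm (mon s) (mon s').
Proof. by elim: s => [|u s IH] /=; rewrite ?mul0cm // IH mulcmA. Qed.

Lemma mon_perm s s' : perm_eq s s' -> mon s = mon s'.
Proof. by move=> E; apply/monP/perm_map. Qed.

Lemma mon_eq1 s : (mon s == onecm CT) = (s == [::]).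
Proof.
case: s => [|u s] /=; first exact: eqxx.
by apply/eqP=> /mulcm_eq0[/eqP/cmP/(_ (cl u))]; rewrite ucmE onecmE eqxx.
Qed.

Lemma mon_forest_list (m : forest) : mon (forest_list m) = m.
Proof.
apply/eqP/cmP => T; rewrite monE /forest_list map_flatten -map_comp.
rewrite count_flatten -map_comp sumnE big_map.
under eq_bigr => U _ do
  rewrite /= map_nseq cl_repr count_nseq /=.
case: (mdomP m T) => [Tm|Tm]; last first.
  rewrite big_seq big1 // => U Um; case: eqP => [E|]; last by rewrite mul0n.
  by rewrite -E Um in Tm.
rewrite (big_fsetD1 T) //= eqxx mul1n big_seq big1 ?addn0 // => U.
by rewrite in_fsetD1 => /andP[/negPf -> _]; rewrite mul0n.
Qed.

(** The operator B^+ on forests, which joins all trees to a new root. *)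
Definition Bplus (m : forest) : CT := cl (Node (forest_list m)).

Lemma cl_NodeE s : cl (Node s) = Bplus (mon s).
Proof. by apply: cl_Node; apply/monP; rewrite mon_forest_list. Qed.

(** Isomorphism of forests is the equivalence generated by swaps of blocks, extension by a common
    head, and a change of the children of the head. Indeed these moves, by induction on trees,
    relate each list to the list of its canonical forms, and isomorphic forests have the same
    canonical forms up to permutation. *)
Lemma forest_iso_ind (R : seq tree -> seq tree -> Prop) :
    (forall s, R s s) ->
    (forall s s', R s s' -> R s' s) ->
    (forall s1 s2 s3, R s1 s2 -> R s2 s3 -> R s1 s3) ->
    (forall s1 s2 s3, R (s1 ++ s2 ++ s3) (s2 ++ s1 ++ s3)) ->
    (forall u s s', R s s' -> R (u :: s) (u :: s')) ->
    (forall s s' q, mon s = mon s' -> R s s' -> R (Node s :: q) (Node s' :: q)) ->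
  forall s s', mon s = mon s' -> R s s'.
Proof.
move=> Rrefl Rsym Rtrans Rswap Rcons RNode.
have Rperm s s' : perm_eq s s' -> R s s'.
  by move=> E; apply: (catCA_perm_ind (P := R s) _ E) => // s1 s2 s3 /Rtrans; apply.
have Rcanons s q : (forall u, u \in s -> forall q, R (u :: q) (canon u :: q)) ->
    R (s ++ q) (map canon s ++ q).
  elim: s => [|u s IH] H //=; apply: (Rtrans _ _ _ (H u (mem_head _ _) _)).
  by apply: Rcons; apply: IH => v vs; apply: H; rewrite inE vs orbT.
have Rcanon t q : R (t :: q) (canon t :: q).
  elim/tree_mem_ind: t q => s IH q /=; apply: RNode; last first.
    apply: (Rtrans _ (map canon s)); last by apply: Rperm; rewrite perm_sym perm_sort.
    by have := Rcanons s [::] IH; rewrite !cats0.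
  rewrite (mon_perm (permEl (perm_sort tle _))).
  elim: s {IH} => [|u s IH] //=; by rewrite IH cl_canon.
move=> s s' /monP E.
have Rs l : R l (map canon l) by have := Rcanons l [::] (fun u _ => Rcanon u); rewrite !cats0.
apply: (Rtrans _ _ _ (Rs s)); apply: Rtrans (Rsym _ _ (Rs s')); apply: Rperm.
have canonE l : map canon l = map (canon \o repr) (map cl l).
  by rewrite -map_comp; apply: eq_map => u /=; rewrite canon_repr.
by rewrite !canonE perm_map.
Qed.

(** * Cuts of forests, studied through sums of arbitrary functions over them *)

(* Cuts of a forest in which a tree may also be pruned as a whole (as if its
   root hung below a virtual vertex), so that [tcuts t] lists the terms of the
   full coproduct of [t], including [t (x) 1]. *)
Definition tcuts (t : tree) : seq (seq tree * seq tree) :=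
  ([:: t], [::]) :: [seq (c.1, [:: c.2]) | c <- cuts t].

Fixpoint fcuts (s : seq tree) : seq (seq tree * seq tree) :=
  if s is t :: s' then
    [seq (y.1 ++ w.1, y.2 ++ w.2) | y <- tcuts t, w <- fcuts s']
  else [:: ([::], [::])].

(** The local fixpoint of [cuts] is [fcuts]: cutting a tree without pruning its root means cutting
    the forest of its children. *)
Lemma cuts_Node s : cuts (Node s) = [seq (w.1, Node w.2) | w <- fcuts s].
Proof.
rewrite /=; congr map.
elim: s => [|t s IH] //=; rewrite IH; congr cat.
by rewrite -map_comp.
Qed.

Section CutSums.
Variable V : nmodType.
Implicit Types (g : seq tree -> seq tree -> V) (s : seq tree).

Lemma sum_fcuts_nil g : \sum_(w <- fcuts [::]) g w.1 w.2 = g [::] [::].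
Proof. by rewrite big_seq1. Qed.

Lemma sum_fcuts_cons g t s :
  \sum_(w <- fcuts (t :: s)) g w.1 w.2 =
  \sum_(y <- tcuts t) \sum_(w <- fcuts s) g (y.1 ++ w.1) (y.2 ++ w.2).
Proof. exact: big_allpairs_dep. Qed.

Lemma sum_fcuts1 g t :
  \sum_(w <- fcuts [:: t]) g w.1 w.2 = \sum_(y <- tcuts t) g y.1 y.2.
Proof.
rewrite sum_fcuts_cons; apply: eq_bigr => y _.
by rewrite (sum_fcuts_nil (fun a b => g (y.1 ++ a) (y.2 ++ b))) !cats0.
Qed.

Lemma sum_fcuts_cat g s1 s2 :
  \sum_(w <- fcuts (s1 ++ s2)) g w.1 w.2 =
  \sum_(w <- fcuts s1) \sum_(z <- fcuts s2) g (w.1 ++ z.1) (w.2 ++ z.2).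
Proof.
elim: s1 g => [|t s1 IH] g.
  by rewrite (sum_fcuts_nil (fun a b => \sum_(z <- fcuts s2) g (a ++ z.1) (b ++ z.2))).
rewrite [_ ++ s2]/= sum_fcuts_cons.
rewrite (sum_fcuts_cons (fun a b => \sum_(z <- fcuts s2) g (a ++ z.1) (b ++ z.2))).
apply: eq_bigr => y _; rewrite (IH (fun a b => g (y.1 ++ a) (y.2 ++ b))).
by apply: eq_bigr => w _; apply: eq_bigr => z _; rewrite !catA.
Qed.

Lemma sum_cuts (g : seq tree -> tree -> V) s :
  \sum_(c <- cuts (Node s)) g c.1 c.2 = \sum_(w <- fcuts s) g w.1 (Node w.2).
Proof. by rewrite cuts_Node big_map. Qed.

Lemma sum_tcuts g t :
  \sum_(y <- tcuts t) g y.1 y.2 =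
  g [:: t] [::] + \sum_(c <- cuts t) g c.1 [:: c.2].
Proof. by rewrite big_cons big_map. Qed.

Lemma sum_tcuts_Node g s :
  \sum_(y <- tcuts (Node s)) g y.1 y.2 =
  g [:: Node s] [::] + \sum_(w <- fcuts s) g w.1 [:: Node w.2].
Proof. by rewrite sum_tcuts (sum_cuts (fun a b => g a [:: b])). Qed.

(* Coassociativity: both sides enumerate pairs of nested cuts. *)
Lemma sum_nested_fcuts (g : seq tree -> seq tree -> seq tree -> V) s :
  \sum_(w <- fcuts s) \sum_(z <- fcuts w.1) g z.1 z.2 w.2 =
  \sum_(w <- fcuts s) \sum_(z <- fcuts w.2) g w.1 z.1 z.2.
Proof.
(* Mutual induction in two halves: [forest_step] carries the claim from the trees of a list to the
   list, and the tree case applies it to the children. The same scheme recurs below. *)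
have forest_step l :
    (forall t, t \in l -> forall h : seq tree -> seq tree -> seq tree -> V,
      \sum_(y <- tcuts t) \sum_(z <- fcuts y.1) h z.1 z.2 y.2 =
      \sum_(y <- tcuts t) \sum_(z <- fcuts y.2) h y.1 z.1 z.2 :> V) ->
    forall h : seq tree -> seq tree -> seq tree -> V,
      \sum_(w <- fcuts l) \sum_(z <- fcuts w.1) h z.1 z.2 w.2 =
      \sum_(w <- fcuts l) \sum_(z <- fcuts w.2) h w.1 z.1 z.2 :> V.
  elim: l => [|t l IH] Hl g0.
    by rewrite !big_seq1.
  rewrite (sum_fcuts_cons (fun a b => \sum_(z <- fcuts a) g0 z.1 z.2 b)).
  rewrite (sum_fcuts_cons (fun a b => \sum_(z <- fcuts b) g0 a z.1 z.2)).
  have IH' := IH (fun u ul => Hl u (mem_behead (s := t :: l) ul)).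
  pose G a b c := \sum_(w <- fcuts l) \sum_(z <- fcuts w.2)
    g0 (a ++ w.1) (b ++ z.1) (c ++ z.2).
  transitivity (\sum_(y <- tcuts t) \sum_(u <- fcuts y.1) G u.1 u.2 y.2).
    apply: eq_bigr => y _; rewrite -[RHS]/(\sum_(u <- fcuts y.1) _).
    rewrite (eq_bigr (fun w => \sum_(u <- fcuts y.1) \sum_(z <- fcuts w.1)
      g0 (u.1 ++ z.1) (u.2 ++ z.2) (y.2 ++ w.2))); last first.
      by move=> w _; rewrite (sum_fcuts_cat (fun a b => g0 a b (y.2 ++ w.2))).
    rewrite exchange_big; apply: eq_bigr => u _.
    exact: (IH' (fun a b c => g0 (u.1 ++ a) (u.2 ++ b) (y.2 ++ c))).
  rewrite (Hl t (mem_head _ _)); apply: eq_bigr => y _.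
  rewrite exchange_big; apply: eq_bigr => w _.
  by rewrite (sum_fcuts_cat (fun a b => g0 (y.1 ++ w.1) a b)).
apply: (forest_step s) => t _; elim/tree_mem_ind: t => l IH {}g.
rewrite (sum_tcuts_Node (fun a b => \sum_(z <- fcuts a) g z.1 z.2 b)).
rewrite (sum_tcuts_Node (fun a b => \sum_(z <- fcuts b) g a z.1 z.2)).
(* Sort the terms by the argument of [g] that receives the root. In the third one, nested cuts of
   the children remain, which is the induction hypothesis; in the second, one cut of the children,
   and in the first a single term, the same on both sides. *)
rewrite (forest_step l IH (fun a b c => g a b [:: Node c])).
rewrite (sum_fcuts1 (fun a b => g a b [::])).
rewrite (sum_tcuts_Node (fun a b => g a b [::])).
rewrite (sum_fcuts_nil (fun a b => g [:: Node l] a b)) -addrA -big_split /=.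
congr (_ + _); apply: eq_bigr => w _.
rewrite (sum_fcuts1 (fun a b => g w.1 a b)).
by rewrite (sum_tcuts_Node (fun a b => g w.1 a b)).
Qed.

(** Makes the coproduct, defined through [repr], computable on any representative. *)
Lemma sum_fcuts_mon (G : forest -> forest -> V) s s' : mon s = mon s' ->
  \sum_(w <- fcuts s) G (mon w.1) (mon w.2) =
  \sum_(w <- fcuts s') G (mon w.1) (mon w.2).
Proof.
pose M (H : forest -> forest -> V) a b := H (mon a) (mon b).
pose R s s' := forall H,
  \sum_(w <- fcuts s) M H w.1 w.2 = \sum_(w <- fcuts s') M H w.1 w.2.
move=> E; apply: (forest_iso_ind (R := R) _ _ _ _ _ _ E) => {E G} {}s.
- by [].
- by move=> {}s' E H.
- by move=> s2 s3 E1 E2 H; rewrite E1 E2.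
- move=> s2 s3 H; rewrite !sum_fcuts_cat.
  under eq_bigr do rewrite (sum_fcuts_cat (fun a b => M H (_ ++ a) (_ ++ b))).
  under [RHS]eq_bigr do rewrite (sum_fcuts_cat (fun a b => M H (_ ++ a) (_ ++ b))).
  rewrite exchange_big; do 3![apply: eq_bigr => ? _].
  by rewrite /M !mon_cat; congr H; apply: (Monoid.mulmCA (mmul (s := forest))).
- move=> u l E H; rewrite !sum_fcuts_cons; apply: eq_bigr => y _.
  have := E (fun a b => H (mulcm (mon y.1) a) (mulcm (mon y.2) b)).
  by rewrite /M; under eq_bigr do rewrite -!mon_cat; under [in RHS]eq_bigr do rewrite -!mon_cat.
- move=> l q Eml E H; rewrite !sum_fcuts_cons.
  rewrite (sum_tcuts_Node (fun a b => \sum_(w <- fcuts q) M H (a ++ w.1) (b ++ w.2))).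
  rewrite (sum_tcuts_Node (fun a b => \sum_(w <- fcuts q) M H (a ++ w.1) (b ++ w.2))).
  congr (_ + _).
    by apply: eq_bigr => w _; rewrite /M /= !cl_NodeE Eml.
  have Nodes l' : \sum_(w <- fcuts l') \sum_(z <- fcuts q)
      M H (w.1 ++ z.1) ([:: Node w.2] ++ z.2) =
    \sum_(w <- fcuts l') \sum_(z <- fcuts q)
      H (mulcm (mon w.1) (mon z.1)) (mulcm (ucm (Bplus (mon w.2))) (mon z.2)).
    by do 2![apply: eq_bigr => ? _]; rewrite /M mon_cat /= cl_NodeE.
  rewrite !Nodes; exact: (E (fun a b => \sum_(z <- fcuts q)
    H (mulcm a (mon z.1)) (mulcm (ucm (Bplus b)) (mon z.2)))).
Qed.
End CutSums.

(** The empty cut is listed exactly once, and its trunk is [s] itself, not merely an isomorphic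
    list. *)
Lemma sum_fcuts_empty (V : nmodType) (g : seq tree -> seq tree -> V) s :
  \sum_(w <- fcuts s) g w.1 w.2 =
  g [::] s + \sum_(w <- fcuts s | w.1 != [::]) g w.1 w.2.
Proof.
have forest_step l :
    (forall t, t \in l -> forall g : seq tree -> seq tree -> V,
      \sum_(y <- tcuts t) (if y.1 == [::] then g y.1 y.2 else 0) = g [::] [:: t]) ->
    forall g : seq tree -> seq tree -> V,
      \sum_(w <- fcuts l) (if w.1 == [::] then g w.1 w.2 else 0) = g [::] l.
  elim: l => [|t l IH] Hl {}g; first by rewrite big_seq1.
  rewrite (sum_fcuts_cons (fun a b => if a == [::] then g a b else 0)).
  have IH' := IH (fun u ul => Hl u (mem_behead (s := t :: l) ul)).
  rewrite -(Hl t (mem_head _ _) (fun a b => g a (b ++ l))).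
  apply: eq_bigr => -[[|u a] b] _ /=; first exact: (IH' (fun a' b' => g a' (b ++ b'))).
  by rewrite big1.
rewrite (bigID (fun w : seq tree * seq tree => w.1 == [::])) /=; congr (_ + _).
rewrite big_mkcond /=; apply: (forest_step s) => t _ {}g.
elim/tree_mem_ind: t g => l IH g.
rewrite (sum_tcuts_Node (fun a b => if a == [::] then g a b else 0)) add0r.
exact: (forest_step l IH (fun a b => g a [:: Node b])).
Qed.

Lemma sum_cuts_empty (V : nmodType) (g : seq tree -> tree -> V) t :
  \sum_(c <- cuts t) g c.1 c.2 = g [::] t + \sum_(c <- cuts t | c.1 != [::]) g c.1 c.2.
Proof.
case: t => s; rewrite sum_cuts (sum_fcuts_empty (fun a b => g a (Node b))).
by rewrite cuts_Node big_map.
Qed.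

(** * Weights *)

Definition wt (s : seq tree) : nat := sumn (map weight s).

Lemma wt_cat s s' : wt (s ++ s') = (wt s + wt s')%N.
Proof. by rewrite /wt map_cat sumn_cat. Qed.

Lemma wt_cons t s : wt (t :: s) = (weight t + wt s)%N.
Proof. by []. Qed.

Lemma weight_Node s : weight (Node s) = (wt s).+1.
Proof. by []. Qed.

Lemma wt_fcuts s w : w \in fcuts s -> (wt w.1 + wt w.2)%N = wt s.
Proof.
have forest_step l :
    (forall t, t \in l -> forall y, y \in tcuts t -> (wt y.1 + wt y.2)%N = weight t) ->
    forall w, w \in fcuts l -> (wt w.1 + wt w.2)%N = wt l.
  elim: l => [|t l IH] Hl {}w; first by rewrite inE => /eqP->.
  case/allpairsP => -[y z] /= [yt zl ->] /=.
  rewrite !wt_cat addnACA (Hl t (mem_head _ _) y yt) (IH _ z zl) // => u ul.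
  by apply: Hl; rewrite inE ul orbT.
apply: (forest_step s) => t _; elim/tree_mem_ind: t => l IH y.
rewrite inE => /orP[/eqP->|]; first by rewrite /wt /= !addn0.
rewrite cuts_Node -map_comp => /mapP[z zl ->] /=.
by rewrite wt_cons weight_Node addn0 addnS (forest_step l IH z zl).
Qed.

Lemma wt_mon s s' : mon s = mon s' -> wt s = wt s'.
Proof.
move=> E; apply: (forest_iso_ind (R := fun s s' => wt s = wt s') _ _ _ _ _ _ E) => //.
- by move=> s1 s2 s3 -> .
- by move=> s1 s2 s3; rewrite !wt_cat addnCA.
- by move=> u l l' E'; rewrite !wt_cons E'.
- by move=> l l' q _ E'; rewrite !wt_cons !weight_Node E'.
Qed.

Lemma weight_mem u s : u \in s -> (weight u <= wt s)%N.
Proof.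
elim: s => [|v s IH] //; rewrite inE wt_cons => /orP[/eqP->|/IH]; first exact: leq_addr.
by move=> us; rewrite (leq_trans us) ?leq_addl.
Qed.

Lemma weight_gt0 t : (0 < weight t)%N.
Proof. by case: t. Qed.

Lemma weight_cuts t c : c \in cuts t -> (wt c.1 + weight c.2)%N = weight t.
Proof.
case: t => s; rewrite cuts_Node => /mapP[w ws ->] /=.
by rewrite addnS -[sumn _]/(wt _) (wt_fcuts ws).
Qed.

Lemma weight_repr t : weight (repr (cl t)) = weight t.
Proof.
have := @wt_mon [:: repr (cl t)] [:: t]; rewrite /wt /= !addn0; apply.
by rewrite cl_repr.
Qed.

(** * Grafting onto forests *)

(** The local loop of [graft_at] without its accumulator of visited siblings, so that grafting below
    a root is again grafting onto a forest. *)
Fixpoint fgraft (ms s : seq tree) : seq (seq tree) :=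
  if s is t :: s' then
    [seq r :: s' | r <- graft_at ms t] ++ [seq t :: q | q <- fgraft ms s']
  else [::].

Lemma graft_at_Node ms s :
  graft_at ms (Node s) = Node (s ++ ms) :: map Node (fgraft ms s).
Proof.
rewrite [LHS]/=; congr cons.
set go := (X in X [::] s).
have goE l pre : go pre l = [seq Node (pre ++ q) | q <- fgraft ms l].
  elim: l pre => [|t l IH] pre //=.
  rewrite map_cat -!map_comp; congr cat; rewrite IH.
  by apply: eq_map => q /=; rewrite cat_rcons.
exact: goE.
Qed.

Section GraftSums.
Variable V : nmodType.

Lemma sum_fgraft_nth (g : seq tree -> V) ms s :
  \sum_(j < size s) \sum_(r <- graft_at ms (nth (Node [::]) s j))
     g (set_nth (Node [::]) s j r) = \sum_(q <- fgraft ms s) g q.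
Proof.
elim: s g => [|t s IH] g; first by rewrite big_ord0 big_nil.
rewrite big_ord_recl /= big_cat !big_map /=; congr (_ + _).
by rewrite -(IH (fun q => g (t :: q))).
Qed.

(** Leibniz rule: the vertex that receives [ms] lies in one of the two parts. *)
Lemma sum_fgraft_cat (g : seq tree -> V) ms s1 s2 :
  \sum_(q <- fgraft ms (s1 ++ s2)) g q =
  \sum_(q <- fgraft ms s1) g (q ++ s2) + \sum_(q <- fgraft ms s2) g (s1 ++ q).
Proof.
elim: s1 g => [|t s IH] g; first by rewrite big_nil add0r.
by rewrite /= !big_cat !big_map /= (IH (fun q => g (t :: q))) addrA.
Qed.

Lemma sum_fgraft_Node (g : seq tree -> V) ms s :
  \sum_(q <- fgraft ms [:: Node s]) g q =
  g [:: Node (s ++ ms)] + \sum_(q <- fgraft ms s) g [:: Node q].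
Proof.
have -> : fgraft ms [:: Node s] = [seq [:: r] | r <- graft_at ms (Node s)] by exact: cats0.
by rewrite graft_at_Node big_map big_cons big_map.
Qed.

Lemma sum_fgraft_mon (G : forest -> V) ms ms' s s' :
  mon ms = mon ms' -> mon s = mon s' ->
  \sum_(q <- fgraft ms s) G (mon q) = \sum_(q <- fgraft ms' s') G (mon q).
Proof.
have fgraft_Node H ns l :
    \sum_(q <- fgraft ns [:: Node l]) H (mon q) =
    H (ucm (Bplus (mulcm (mon l) (mon ns)))) +
    \sum_(q <- fgraft ns l) H (ucm (Bplus (mon q))) :> V.
  rewrite (sum_fgraft_Node (fun q => H (mon q))) /= mulcm0 cl_NodeE mon_cat.
  by congr (_ + _); apply: eq_bigr => q _; rewrite mulcm0 cl_NodeE.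
have fgraft_cons H ns t l :
    \sum_(q <- fgraft ns (t :: l)) H (mon q) =
    \sum_(q <- fgraft ns [:: t]) H (mulcm (mon q) (mon l)) +
    \sum_(q <- fgraft ns l) H (mulcm (ucm (cl t)) (mon q)) :> V.
  rewrite -cat1s (sum_fgraft_cat (fun q => H (mon q))).
  by congr (_ + _); apply: eq_bigr => q _; rewrite mon_cat.
move=> Ems Es; transitivity (\sum_(q <- fgraft ms' s) G (mon q)).
  have step l : (forall t, t \in l -> forall H,
        \sum_(q <- fgraft ms [:: t]) H (mon q) =
        \sum_(q <- fgraft ms' [:: t]) H (mon q) :> V) ->
      forall H, \sum_(q <- fgraft ms l) H (mon q) =
        \sum_(q <- fgraft ms' l) H (mon q) :> V.
    elim: l => [|t l IH] Hl H; first by rewrite !big_nil.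
    rewrite !(fgraft_cons _ _ t) (Hl t (mem_head _ _) (fun m => H (mulcm m (mon l)))).
    rewrite (IH _ (fun m => H (mulcm (ucm (cl t)) m))) // => u ul.
    by apply: Hl; rewrite inE ul orbT.
  apply: (step s) => t _; elim/tree_mem_ind: t => l IH H.
  by rewrite !fgraft_Node Ems (step l IH (fun m => H (ucm (Bplus m)))).
(* The equality of monomials is part of [R] because the common-head case of [forest_iso_ind]
   supplies only [R], and the tail occurs there as a factor [mon l]. *)
pose R s s' := mon s = mon s' /\ forall H,
  \sum_(q <- fgraft ms' s) H (mon q) = \sum_(q <- fgraft ms' s') H (mon q) :> V.
suff: forall s s', mon s = mon s' -> R s s' by move=> RE; case: (RE _ _ Es).
apply: forest_iso_ind; rewrite {}/R.
- by [].
- by move=> s1 s2 [-> E]; split=> // H; rewrite E.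
- by move=> s1 s2 s3 [-> E1] [-> E2]; split=> // H; rewrite E1 E2.
- move=> s1 s2 s3; split=> [|H].
    by rewrite !mon_cat; apply: (Monoid.mulmCA (mmul (s := forest))).
  rewrite !(sum_fgraft_cat (fun q => H (mon q))).
  rewrite !(sum_fgraft_cat (fun q => H (mon (_ ++ q)))) addrCA.
  congr (_ + (_ + _)); apply: eq_bigr => q _; congr H; rewrite !mon_cat;
    exact: (Monoid.mulmCA (mmul (s := forest))).
- move=> t l l' [El E]; split=> [|H]; first by rewrite /= El.
  by rewrite !(fgraft_cons _ _ t) El (E (fun m => H (mulcm (ucm (cl t)) m))).
- move=> l l' q _ [El E]; split=> [|H]; first by rewrite /= !cl_NodeE El.
  rewrite !(fgraft_cons _ _ (Node _)) !cl_NodeE El; congr (_ + _).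
  rewrite !(fgraft_Node (fun m => H (mulcm m (mon q)))) El.
  by rewrite (E (fun m => H (mulcm (ucm (Bplus m)) (mon q)))).
Qed.

(* A cut of a grafted forest either prunes the vertex carrying [ms], and then
   [ms] with it, or keeps that vertex and cuts [ms] independently. *)
Lemma sum_fcuts_fgraft (g : forest -> seq tree -> V) ms s :
  \sum_(q <- fgraft ms s) \sum_(w <- fcuts q) g (mon w.1) w.2 =
  \sum_(w <- fcuts s) (\sum_(p <- fgraft ms w.1) g (mon p) w.2 +
    \sum_(z <- fcuts ms) \sum_(r <- fgraft z.2 w.2) g (mulcm (mon w.1) (mon z.1)) r).
Proof.
pose rhs (h : forest -> seq tree -> V) a b := \sum_(p <- fgraft ms a) h (mon p) b +
    \sum_(z <- fcuts ms) \sum_(r <- fgraft z.2 b) h (mulcm (mon a) (mon z.1)) r.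
(* The contribution of one cut obeys the same Leibniz rule as grafting; this is what carries the
   claim from trees to forests. *)
have rhs_cat h a1 a2 b1 b2 : rhs h (a1 ++ a2) (b1 ++ b2) =
    rhs (fun m r => h (mulcm m (mon a2)) (r ++ b2)) a1 b1 +
    rhs (fun m r => h (mulcm (mon a1) m) (b1 ++ r)) a2 b2.
  rewrite /rhs (sum_fgraft_cat (fun p => h (mon p) (b1 ++ b2))) addrACA.
  under [X in _ + X]eq_bigr => z _.
    rewrite (sum_fgraft_cat (fun r => h (mulcm (mon (a1 ++ a2)) (mon z.1)) r)).
    over.
  rewrite big_split /=; congr ((_ + _) + (_ + _)).
  - by apply: eq_bigr => p _; rewrite mon_cat.
  - by apply: eq_bigr => p _; rewrite mon_cat.
  - do 2![apply: eq_bigr => ? _]; rewrite mon_cat.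
    by congr (h _ _); apply: (Monoid.mulmAC (mmul (s := forest))).
  - by do 2![apply: eq_bigr => ? _]; rewrite mon_cat mulcmA.
have rhs_sum (J : Type) (r : seq J) F a b :
    rhs (fun m q => \sum_(j <- r) F j m q) a b = \sum_(j <- r) rhs (F j) a b.
  rewrite /rhs big_split /= [LHS]addrC exchange_big addrC; congr (_ + _).
  rewrite [RHS]exchange_big; apply: eq_bigr => z _; exact: exchange_big.
have step l : (forall t, t \in l -> forall h : forest -> seq tree -> V,
      \sum_(r <- graft_at ms t) \sum_(y <- tcuts r) h (mon y.1) y.2 =
      \sum_(y <- tcuts t) rhs h y.1 y.2) ->
    forall h : forest -> seq tree -> V,
      \sum_(q <- fgraft ms l) \sum_(w <- fcuts q) h (mon w.1) w.2 =
      \sum_(w <- fcuts l) rhs h w.1 w.2.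
  elim: l => [|t l IH] Hl h.
    rewrite big_nil (sum_fcuts_nil (rhs h)) /rhs big_nil add0r.
    by rewrite big1 // => z _; rewrite big_nil.
  rewrite /= big_cat !big_map /= (sum_fcuts_cons (rhs h)).
  under [RHS]eq_bigr => y _ do
    (under eq_bigr => w _ do rewrite rhs_cat; rewrite big_split).
  rewrite big_split /=; congr (_ + _).
    under eq_bigr => r _ do rewrite (sum_fcuts_cons (fun a b => h (mon a) b)).
    under [RHS]eq_bigr => y _ do rewrite -rhs_sum.
    rewrite -(Hl t (mem_head _ _)); do 3![apply: eq_bigr => ? _].
    by rewrite mon_cat.
  under eq_bigr => q _ do rewrite (sum_fcuts_cons (fun a b => h (mon a) b)).
  rewrite exchange_big; apply: eq_bigr => y _; rewrite -IH; last first.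
    by move=> u ul; apply: Hl; rewrite inE ul orbT.
  by do 2![apply: eq_bigr => ? _]; rewrite mon_cat.
apply: (step s) => t _; elim/tree_mem_ind: t => l IH {}h.
rewrite graft_at_Node big_cons big_map (sum_tcuts_Node (rhs h)).
under eq_bigr => q _ do rewrite (sum_tcuts_Node (fun a b => h (mon a) b)).
rewrite (sum_tcuts_Node (fun a b => h (mon a) b)) big_split /= addrACA.
rewrite (step l IH (fun m r => h m [:: Node r])); congr (_ + _).
  rewrite {1}/rhs (sum_fgraft_Node (fun p => h (mon p) [::])).
  by rewrite [X in _ = _ + X]big1 ?addr0 // => z _; rewrite big_nil.
(* What remains is [ms] grafted at the root, with the root kept: a cut of [l ++ ms] is a cut of [l]
   together with a cut of [ms], that is, the term of [rhs] grafting [z.2] at the root of the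
   trunk. *)
rewrite (sum_fcuts_cat (fun a b => h (mon a) [:: Node b])) -big_split /=.
apply: eq_bigr => w _; rewrite /rhs addrCA; congr (_ + _).
rewrite -big_split; apply: eq_bigr => z _ /=; rewrite mon_cat.
by rewrite (sum_fgraft_Node (fun r => h (mulcm (mon w.1) (mon z.1)) r)).
Qed.
End GraftSums.

(** * Linear and multiplicative extension from monomials *)

Section LinearExtension.
Variables (K : choiceType) (V : lmodType rat) (h : K -> V).

Definition linext (g : {malg rat[K]}) : V := \sum_(k <- msupp g) g@_k *: h k.

Lemma linextEw (d : {fset K}) (g : {malg rat[K]}) :
  (msupp g `<=` d)%fset -> linext g = \sum_(k <- d) g@_k *: h k.
Proof.
move=> gd; apply: (big_fset_incl _ gd) => k _ /mcoeff_outdom ->.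
by rewrite scale0r.
Qed.

Lemma linext_is_linear : linear linext.
Proof.
move=> a x y /=.
rewrite (@linextEw (msupp x `|` msupp y)%fset (a *: x + y)); last first.
  by rewrite (fsubset_trans (msuppD_le _ _)) // fsetSU // msuppZ_le.
rewrite (linextEw (fsubsetUl _ (msupp y))) (linextEw (fsubsetUr (msupp x) _)).
rewrite scaler_sumr -big_split /=; apply: eq_bigr => k _.
by rewrite mcoeffD mcoeffZ scalerDl scalerA.
Qed.

HB.instance Definition _ :=
  GRing.isLinear.Build rat {malg rat[K]} V _ linext linext_is_linear.

Lemma linextU k : linext << k >> = h k.
Proof. by rewrite /linext msuppU oner_eq0 big_seq_fset1 mcoeffUU scale1r. Qed.

End LinearExtension.

Lemma malgUZ (K : choiceType) (c : rat) (k : K) : << c *g k >> = c *: << k >>.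
Proof. by apply/malgP => j; rewrite mcoeffZ !mcoeffU mulrnAr mulr1. Qed.

Lemma malgU1M (K : conomType) (k1 k2 : K) :
  << k1 >> * << k2 >> = << mmul k1 k2 >> :> {malg rat[K]}.
Proof. by rewrite [LHS]malgM_def fgmulUU mulr1. Qed.

Lemma forest_polyE s : forest_poly s = << mon s >>.
Proof.
elim: s => [|u s IH]; first by rewrite /forest_poly big_nil.
rewrite /forest_poly big_cons -/(forest_poly s) IH.
exact: malgU1M.
Qed.

Lemma forest_poly_nil : forest_poly [::] = 1.
Proof. exact: big_nil. Qed.

Lemma forest_poly1 t : forest_poly [:: t] = X (cl t).
Proof. exact: big_seq1. Qed.

Lemma forest_poly_cat s s' : forest_poly (s ++ s') = forest_poly s * forest_poly s'.
Proof. exact: big_cat. Qed.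

Lemma HR_lin_ind (Q : HR -> Prop) :
    (forall s, Q (forest_poly s)) ->
    (forall a x y, Q x -> Q y -> Q (a *: x + y)) ->
  forall x, Q x.
Proof.
move=> Qs QD x; have Q0 : Q 0.
  by rewrite -(addNr (forest_poly [::])) -scaleN1r; apply: QD.
rewrite (monalgE x); elim/big_rec: _ => // m y _ Qy.
have -> : << x@_m *g m >> = x@_m *: forest_poly (forest_list m).
  by rewrite forest_polyE mon_forest_list; apply: malgUZ.
exact: QD.
Qed.

Section MonomialProduct.
Variables (I : choiceType) (A : comAlgType rat) (h : I -> A).

Definition monprod (m : cmonom I) : A := \prod_(i <- finsupp m) h i ^+ m i.

Lemma monprodEw (d : {fset I}) (m : {cmonom I}) :
  (finsupp m `<=` d)%fset -> monprod m = \prod_(i <- d) h i ^+ m i.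
Proof.
move=> md; apply: (big_fset_incl _ md) => i _.
by rewrite -cmE_eq0 => /eqP->.
Qed.

Lemma monprod1 : monprod (onecm I) = 1.
Proof. by rewrite /monprod mdom1 big_seq_fset0. Qed.

Lemma monprodU i : monprod (ucm i) = h i.
Proof. by rewrite /monprod mdomU big_seq_fset1 cmUU expr1. Qed.

Lemma monprodM m1 m2 : monprod (mulcm m1 m2) = monprod m1 * monprod m2.
Proof.
pose d := (finsupp m1 `|` finsupp m2)%fset.
rewrite (@monprodEw d m1 (fsubsetUl _ _)) (@monprodEw d m2 (fsubsetUr _ _)).
rewrite /monprod mdomD -/d -big_split /=; apply: eq_bigr => i _.
by rewrite cmM exprD.
Qed.

End MonomialProduct.

Lemma alg_extE (A : comAlgType rat) (h : CT -> A) g :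
  alg_ext h g = linext (monprod h) g.
Proof. reflexivity. Qed.

Lemma alg_ext_forest (A : comAlgType rat) (h : CT -> A) s :
  alg_ext h (forest_poly s) = \prod_(u <- s) h (cl u).
Proof.
rewrite alg_extE forest_polyE linextU.
elim: s => [|u s IH]; first (rewrite big_nil monprod1; reflexivity).
rewrite big_cons -IH monprodM monprodU; reflexivity.
Qed.

Lemma alg_ext_linear (A : comAlgType rat) (h : CT -> A) a x y :
  alg_ext h (a *: x + y) = a *: alg_ext h x + alg_ext h y.
Proof. exact: (linearP (linext (monprod h))). Qed.

Lemma scaleDMl (A : comAlgType rat) a (x x' y : A) :
  (a *: x + x') * y = a *: (x * y) + x' * y.
Proof. by rewrite mulrDl scalerAl. Qed.

Lemma scaleDMr (A : comAlgType rat) a (x y y' : A) :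
  x * (a *: y + y') = a *: (x * y) + x * y'.
Proof. by rewrite mulrDr scalerAr. Qed.

(** * Tensors and the coproduct of a forest *)

Definition embl : HR -> HR2 := alg_ext (fun T => X2 (inl T)).
Definition embr : HR -> HR2 := alg_ext (fun T => X2 (inr T)).

Lemma tensE x y : tens x y = embl x * embr y.
Proof. reflexivity. Qed.

Lemma embl_linear a x y : embl (a *: x + y) = a *: embl x + embl y.
Proof. exact: alg_ext_linear. Qed.

Lemma embr_linear a x y : embr (a *: x + y) = a *: embr x + embr y.
Proof. exact: alg_ext_linear. Qed.

Lemma embl_forest s : embl (forest_poly s) = \prod_(u <- s) X2 (inl (cl u)).
Proof. exact: alg_ext_forest. Qed.

Lemma embr_forest s : embr (forest_poly s) = \prod_(u <- s) X2 (inr (cl u)).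
Proof. exact: alg_ext_forest. Qed.

Lemma tens_linearl y a x x' : tens (a *: x + x') y = a *: tens x y + tens x' y.
Proof. rewrite !tensE (embl_linear a x x'); exact: scaleDMl. Qed.

Lemma tens_linearr x a y y' : tens x (a *: y + y') = a *: tens x y + tens x y'.
Proof. rewrite !tensE (embr_linear a y y'); exact: scaleDMr. Qed.

Lemma tens_forest s t : tens (forest_poly s) (forest_poly t) =
  (\prod_(u <- s) X2 (inl (cl u))) * (\prod_(u <- t) X2 (inr (cl u))).
Proof. rewrite tensE embl_forest embr_forest; reflexivity. Qed.

Lemma prodMACA (A : comAlgType rat) (I J : Type) (s1 s2 : seq I) (t1 t2 : seq J)
    (f : I -> A) (h : J -> A) :
  (\prod_(i <- s1 ++ s2) f i) * (\prod_(j <- t1 ++ t2) h j) =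
  ((\prod_(i <- s1) f i) * (\prod_(j <- t1) h j)) *
  ((\prod_(i <- s2) f i) * (\prod_(j <- t2) h j)).
Proof. by rewrite !big_cat mulrACA. Qed.

Lemma tens_forest_cat s1 s2 t1 t2 :
  tens (forest_poly (s1 ++ s2)) (forest_poly (t1 ++ t2)) =
  tens (forest_poly s1) (forest_poly t1) * tens (forest_poly s2) (forest_poly t2).
Proof. rewrite !tens_forest; exact: prodMACA. Qed.

Section LinearFunctions.
Variables (U V : lmodType rat) (f : U -> V).
Hypothesis f_lin : linear f.

Lemma lin0 : f 0 = 0.
Proof. by rewrite -[X in f X](addNr 0) -scaleN1r f_lin scaleN1r addNr. Qed.

Lemma linD x y : f (x + y) = f x + f y.
Proof. by rewrite -[x in LHS]scale1r f_lin scale1r. Qed.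

Lemma linZ a x : f (a *: x) = a *: f x.
Proof. by rewrite -[X in f X]addr0 f_lin lin0 addr0. Qed.

Lemma linN x : f (- x) = - f x.
Proof. by rewrite -scaleN1r linZ scaleN1r. Qed.

Lemma linB x y : f (x - y) = f x - f y.
Proof. by rewrite linD linN. Qed.

Lemma lin_sum (I : Type) (r : seq I) (P : pred I) (F : I -> U) :
  f (\sum_(i <- r | P i) F i) = \sum_(i <- r | P i) f (F i).
Proof. exact: (big_morph _ linD lin0). Qed.

End LinearFunctions.

Lemma HR_lin_eq (V : lmodType rat) (f g : HR -> V) :
  linear f -> linear g -> (forall s, f (forest_poly s) = g (forest_poly s)) ->
  forall x, f x = g x.
Proof.
move=> fl gl E; apply: HR_lin_ind; first exact: E.
by move=> a x y Ex Ey; rewrite fl gl Ex Ey.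
Qed.

Definition ften (a b : seq tree) : HR2 := tens (forest_poly a) (forest_poly b).

Lemma ften_mon a b : ften a b = tens << mon a >> << mon b >>.
Proof. rewrite /ften !forest_polyE; reflexivity. Qed.

Lemma sum_ften_mon s s' : mon s = mon s' ->
  \sum_(w <- fcuts s) ften w.1 w.2 = \sum_(w <- fcuts s') ften w.1 w.2.
Proof.
move=> E; have F := @sum_fcuts_mon _ (fun m n => tens << m >> << n >>) s s' E.
etransitivity; last (etransitivity; first exact: F).
  by apply: eq_bigr => w _; apply: ften_mon.
by apply: eq_bigr => w _; apply/esym/ften_mon.
Qed.

Lemma addrCr (W : zmodType) (a b c : W) : a + (b + c) = b + a + c.
Proof. by rewrite addrA (addrC a). Qed.

(** The two outer terms of [Delta_gen] become cuts: pruning the whole tree gives t (x) 1, the empty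
    cut gives 1 (x) t. *)
Lemma Delta_gen_cl t : Delta_gen (cl t) = \sum_(y <- tcuts t) ften y.1 y.2.
Proof.
rewrite -(sum_fcuts1 ften).
rewrite -(@sum_ften_mon [:: repr (cl t)]); last by rewrite /= cl_repr.
rewrite (sum_fcuts1 ften) (sum_tcuts ften).
rewrite (sum_cuts_empty (fun a b => ften a [:: b])) /Delta_gen /adm_cuts big_filter.
rewrite /ften forest_poly_nil forest_poly1 cl_repr.
transitivity (tens 1 (X (cl t)) + tens (X (cl t)) 1 +
  \sum_(c <- cuts (repr (cl t)) | c.1 != [::])
     tens (forest_poly c.1) (forest_poly [:: c.2])); last by symmetry; exact: addrCr.
apply: (congr2 _ erefl); apply: eq_bigr => c _; rewrite forest_poly1; reflexivity.
Qed.

Lemma prod_sums (A : comAlgType rat) (I J : Type) (r : seq I) (r' : seq J)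
    (f : I -> A) (g : J -> A) :
  (\sum_(i <- r) f i) * (\sum_(j <- r') g j) = \sum_(i <- r) \sum_(j <- r') f i * g j.
Proof. exact: big_distrlr. Qed.

Lemma prod_nil (A : comAlgType rat) (I J : Type) (f : I -> A) (g : J -> A) :
  (\prod_(i <- [::]) f i) * (\prod_(j <- [::]) g j) = 1.
Proof. by rewrite !big_nil mulr1. Qed.

Lemma Delta_forest s : Delta (forest_poly s) = \sum_(w <- fcuts s) ften w.1 w.2.
Proof.
rewrite /Delta alg_ext_forest; elim: s => [|t s IH].
  rewrite big_nil (sum_fcuts_nil ften) /ften tens_forest; symmetry; exact: prod_nil.
rewrite big_cons IH Delta_gen_cl (sum_fcuts_cons ften).
etransitivity; first exact: prod_sums.
apply: eq_bigr => y _; apply: eq_bigr => w _; symmetry; exact: tens_forest_cat.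
Qed.

Lemma Delta_linear : linear Delta.
Proof. move=> a x y; exact: alg_ext_linear. Qed.

Definition monl (s : seq tree) : {cmonom (CT + CT)%type} :=
  foldr (fun u => mulcm (ucm (inl (cl u)))) (onecm _) s.
Definition monr (s : seq tree) : {cmonom (CT + CT)%type} :=
  foldr (fun u => mulcm (ucm (inr (cl u)))) (onecm _) s.

Lemma prod_malgU (I : choiceType) (T : Type) (f : T -> I) (s : seq T) :
  \prod_(u <- s) (<< ucm (f u) >> : {malg rat[{cmonom I}]}) =
  << foldr (fun u => mulcm (ucm (f u))) (onecm I) s >>.
Proof.
elim: s => [|u s IH]; first exact: big_nil.
rewrite big_cons IH; exact: malgU1M.
Qed.

Lemma ftenE a b : ften a b = << mulcm (monl a) (monr b) >>.
Proof.
rewrite /ften tens_forest; etransitivity; last exact: malgU1M.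
exact: congr2 (prod_malgU _ _) (prod_malgU _ _).
Qed.

Definition factorl (v : (CT + CT)%type) : HR := if v is inl T then X T else 1.
Definition factorr (v : (CT + CT)%type) : HR := if v is inr T then X T else 1.

Lemma mleftE m : mleft m = monprod factorl m.
Proof.
rewrite /mleft /monprod; apply: eq_bigr => -[T|T] _; first reflexivity.
symmetry; exact: expr1n.
Qed.

Lemma mrightE m : mright m = monprod factorr m.
Proof.
rewrite /mright /monprod; apply: eq_bigr => -[T|T] _; last reflexivity.
symmetry; exact: expr1n.
Qed.

Lemma monprod_foldr (I : choiceType) (A : comAlgType rat) (h : I -> A)
    (T : Type) (f : T -> I) (s : seq T) :
  monprod h (foldr (fun u => mulcm (ucm (f u))) (onecm I) s) = \prod_(u <- s) h (f u).
Proof.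
elim: s => [|u s IH]; first by rewrite big_nil monprod1.
by rewrite big_cons /= monprodM monprodU IH.
Qed.

Lemma mleft_ften a b : mleft (mulcm (monl a) (monr b)) = forest_poly a.
Proof.
rewrite mleftE monprodM !monprod_foldr /forest_poly /=.
etransitivity; last exact: mulr1.
refine (congr2 _ erefl _); exact: big1_eq.
Qed.

Lemma mright_ften a b : mright (mulcm (monl a) (monr b)) = forest_poly b.
Proof.
rewrite mrightE monprodM !monprod_foldr /forest_poly /=.
etransitivity; last exact: mul1r.
refine (congr2 _ _ erefl); exact: big1_eq.
Qed.

(** * Linear maps out of the tensor product *)

Section Lift.
Variables (V : lmodType rat) (beta : HR -> HR -> V).

(** For bilinear [beta] this is the map given by the universal property of the tensor product
    ([lift2_tens]). Being defined on monomials, it is linear whatever [beta] is. *)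
Definition lift2 : HR2 -> V := linext (fun m => beta (mleft m) (mright m)).

Lemma lift2_linear : linear lift2.
Proof. exact: linext_is_linear. Qed.

(* On basis tensors this holds for arbitrary, even weight-dependent, [beta]. *)
Lemma lift2_ften a b : lift2 (ften a b) = beta (forest_poly a) (forest_poly b).
Proof. rewrite ftenE /lift2 linextU mleft_ften mright_ften; reflexivity. Qed.

Lemma lift2_tens : (forall y, linear (beta^~ y)) -> (forall x, linear (beta x)) ->
  forall x y, lift2 (tens x y) = beta x y.
Proof.
move=> bl br x y; move: x; apply: HR_lin_eq; last move=> s.
- by move=> a x x'; rewrite tens_linearl lift2_linear.
- exact: bl.
move: y; apply: HR_lin_eq; last by move=> s'; apply: lift2_ften.
- by move=> a y y'; rewrite tens_linearr lift2_linear.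
- exact: br.
Qed.

End Lift.

(** * The product T and its cocycle identity *)

Definition graftf (ms s : seq tree) : HR := \sum_(q <- fgraft ms s) forest_poly q.

Lemma graftf_mon ms ms' s s' :
  mon ms = mon ms' -> mon s = mon s' -> graftf ms s = graftf ms' s'.
Proof.
move=> Ems Es; have F := sum_fgraft_mon (fun m => << m >> : HR) Ems Es.
rewrite /graftf; etransitivity; last (etransitivity; first exact: F).
  by apply: eq_bigr => q _; apply: forest_polyE.
by apply: eq_bigr => q _; symmetry; apply: forest_polyE.
Qed.

(* The product [top] without its division by the weight: a derivation in its
   second argument. *)
Definition graft (x y : HR) : HR :=
  linext (fun m : forest =>
    linext (fun n : forest => graftf (forest_list m) (forest_list n)) y) x.

Lemma graft_linearl y : linear (graft^~ y).
Proof. exact: linext_is_linear. Qed.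

Lemma graft_forestl ms y : graft (forest_poly ms) y =
  linext (fun n : forest => graftf (forest_list (mon ms)) (forest_list n)) y.
Proof. rewrite forest_polyE; exact: linextU. Qed.

Lemma graft_forest ms s : graft (forest_poly ms) (forest_poly s) = graftf ms s.
Proof.
rewrite graft_forestl forest_polyE linextU.
by apply: graftf_mon; rewrite mon_forest_list.
Qed.

Lemma scale_comb (V : lmodType rat) (a b : rat) (u u' v v' : V) :
  a *: (b *: u + u') + (b *: v + v') = b *: (a *: u + v) + (a *: u' + v').
Proof. by rewrite !scalerDr !scalerA (mulrC a) addrACA. Qed.

Lemma graft_linearr x : linear (graft x).
Proof.
move=> a y y'; move: x; apply: HR_lin_ind => [ms|b x x' Ex Ex'].
  rewrite !graft_forestl; exact: linext_is_linear.
rewrite !(graft_linearl _ b x x') Ex Ex'; exact: scale_comb.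
Qed.

(** Inverse of the operator that multiplies a forest by its weight, except that it kills 1, as 0^-1
    = 0; this agrees with the convention M T 1 = 0. *)
Definition theta : HR -> HR :=
  linext (fun n : forest => (wt (forest_list n))%:R^-1 *: (<< n >> : HR)).

Lemma theta_linear : linear theta.
Proof. exact: linext_is_linear. Qed.

Lemma theta_forest s : theta (forest_poly s) = (wt s)%:R^-1 *: forest_poly s.
Proof.
rewrite forest_polyE /theta linextU.
by rewrite (wt_mon (mon_forest_list (mon s))).
Qed.

Lemma top_monoE m n : top_mono m n =
  (wt (forest_list n))%:R^-1 *: graftf (forest_list m) (forest_list n).
Proof.
rewrite /top_mono /graftf; case: (forest_list n) => [|t s].
  by rewrite big_nil scaler0.
by rewrite -sum_fgraft_nth.
Qed.

Lemma top_linext x y : top x y = linext (fun m => linext (top_mono m) y) x.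
Proof.
rewrite /top /linext; apply: eq_bigr => m _; rewrite scaler_sumr.
by apply: eq_bigr => n _; rewrite scalerA.
Qed.

Lemma top_forestl ms y : top (forest_poly ms) y = linext (top_mono (mon ms)) y.
Proof. rewrite top_linext forest_polyE; exact: linextU. Qed.

Lemma top_linearl y : linear (top^~ y).
Proof. move=> a x x'; rewrite /= !top_linext; exact: linext_is_linear. Qed.

Lemma top_forest ms s :
  top (forest_poly ms) (forest_poly s) = (wt s)%:R^-1 *: graftf ms s.
Proof.
rewrite top_forestl forest_polyE linextU top_monoE.
rewrite (wt_mon (mon_forest_list (mon s))); congr (_ *: _).
by apply: graftf_mon; rewrite mon_forest_list.
Qed.

Lemma topE x y : top x y = graft x (theta y).
Proof.
move: x; apply: HR_lin_eq; [exact: top_linearl | exact: graft_linearl |] => ms.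
move: y; apply: HR_lin_eq => [a y y'|a y y'|s].
- rewrite !top_forestl; exact: linext_is_linear.
- rewrite theta_linear; exact: graft_linearr.
rewrite top_forest theta_forest (linZ (graft_linearr _)) graft_forest; reflexivity.
Qed.

Lemma tens_suml (I : Type) (r : seq I) (P : pred I) (F : I -> HR) y :
  tens (\sum_(i <- r | P i) F i) y = \sum_(i <- r | P i) tens (F i) y.
Proof. exact: (lin_sum (tens_linearl y)). Qed.

Lemma tens_sumr (I : Type) (r : seq I) (P : pred I) (F : I -> HR) x :
  tens x (\sum_(i <- r | P i) F i) = \sum_(i <- r | P i) tens x (F i).
Proof. exact: (lin_sum (tens_linearr x)). Qed.

Lemma lift2_Delta_forest (V : lmodType rat) (beta : HR -> HR -> V) s :
  lift2 beta (Delta (forest_poly s)) =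
  \sum_(w <- fcuts s) beta (forest_poly w.1) (forest_poly w.2).
Proof.
rewrite Delta_forest (lin_sum (lift2_linear beta)).
by apply: eq_bigr => w _; apply: lift2_ften.
Qed.

Lemma addr_linear (U V : lmodType rat) (f g : U -> V) :
  linear f -> linear g -> linear (fun x => f x + g x).
Proof. by move=> fl gl a x y; rewrite fl gl scalerDr addrACA. Qed.

Lemma comp_linear (U V W : lmodType rat) (f : V -> W) (g : U -> V) :
  linear f -> linear g -> linear (fun x => f (g x)).
Proof. by move=> fl gl a x y; rewrite gl fl. Qed.

(** [graft_cocyclel] collects the cuts of a graft that prune the receiving vertex, [graft_cocycler]
    those that keep it and cut the grafted forest [ms]. *)
Definition graft_cocyclel (x : HR) : HR2 -> HR2 :=
  lift2 (fun a b => tens (graft x a) b).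
Definition graft_cocycler (ms : seq tree) (y : HR2) : HR2 :=
  \sum_(z <- fcuts ms)
    lift2 (fun a b => tens (forest_poly z.1 * a) (graft (forest_poly z.2) b)) y.

Lemma graft_cocycler_linear ms : linear (graft_cocycler ms).
Proof.
move=> a x y; rewrite /graft_cocycler scaler_sumr -big_split.
by apply: eq_bigr => z _; apply: lift2_linear.
Qed.

Lemma Delta_graft_forest ms y :
  Delta (graft (forest_poly ms) y) =
  graft_cocyclel (forest_poly ms) (Delta y) + graft_cocycler ms (Delta y).
Proof.
move: y; apply: HR_lin_eq => [||s].
- exact: comp_linear Delta_linear (graft_linearr _).
- apply: addr_linear; first exact: comp_linear (lift2_linear _) Delta_linear.
  exact: comp_linear (@graft_cocycler_linear ms) Delta_linear.
rewrite graft_forest /graftf (lin_sum Delta_linear).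
have step g : \sum_(q <- fgraft ms s) \sum_(w <- fcuts q) g (mon w.1) w.2 =
  \sum_(w <- fcuts s) \sum_(p <- fgraft ms w.1) g (mon p) w.2 +
  \sum_(z <- fcuts ms) \sum_(w <- fcuts s) \sum_(r <- fgraft z.2 w.2)
     g (mulcm (mon w.1) (mon z.1)) r :> HR2.
  rewrite sum_fcuts_fgraft big_split; congr (_ + _); exact: exchange_big.
transitivity (\sum_(q <- fgraft ms s) \sum_(w <- fcuts q)
    tens << mon w.1 >> (forest_poly w.2)).
  apply: eq_bigr => q _; rewrite Delta_forest; apply: eq_bigr => w _.
  rewrite /ften (forest_polyE w.1); reflexivity.
rewrite (step (fun m r => tens << m >> (forest_poly r))).
refine (congr2 _ _ _).
  rewrite /graft_cocyclel lift2_Delta_forest; apply: eq_bigr => w _.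
  rewrite graft_forest tens_suml; apply: eq_bigr => p _.
  rewrite (forest_polyE p); reflexivity.
rewrite /graft_cocycler; apply: eq_bigr => z _.
rewrite lift2_Delta_forest; apply: eq_bigr => w _.
rewrite graft_forest tens_sumr; apply: eq_bigr => r _.
rewrite -forest_poly_cat -mulcmC -mon_cat -forest_polyE; reflexivity.
Qed.

Lemma graft1 x : graft x 1 = 0.
Proof.
move: x; apply: HR_lin_eq => [||s]; first exact: graft_linearl.
  by move=> a x y; rewrite scaler0 addr0.
rewrite -forest_poly_nil graft_forest; exact: big_nil.
Qed.

Lemma mulr_linear (A : comAlgType rat) (x : A) : linear ( *%R x).
Proof. by move=> a y y'; apply: scaleDMr. Qed.

(* Since the weights in [theta] grade the coproduct, [theta] preserves
   primitive elements. *)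
Lemma theta_primitive p : primitive p -> primitive (theta p).
Proof.
move=> prim_p.
(* A nonlinear extension of the weight to all of [HR]. Only its values on forests matter, since
   [lift2] evaluates [scale] at pairs of monomials. *)
pose w (x : HR) := \sum_(m <- msupp x) (wt (forest_list m))%N.
have wE s : w (forest_poly s) = wt s.
  rewrite /w forest_polyE msuppU oner_eq0 big_seq_fset1.
  exact: wt_mon (mon_forest_list _).
pose scale a b : HR2 := ((w a + w b)%N)%:R^-1 *: tens a b.
have Delta_theta x : Delta (theta x) = lift2 scale (Delta x).
  move: x; apply: HR_lin_eq => [||s].
  - exact: comp_linear Delta_linear theta_linear.
  - exact: comp_linear (lift2_linear _) Delta_linear.
  rewrite theta_forest (linZ Delta_linear) Delta_forest scaler_sumr.
  rewrite (lin_sum (lift2_linear _)) !(big_seq_cond predT) /=.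
  apply: eq_bigr => v /andP[vs _].
  rewrite lift2_ften /scale !wE (wt_fcuts vs); reflexivity.
have scalel x : lift2 scale (tens x 1) = tens (theta x) 1.
  move: x; apply: HR_lin_eq => [||s].
  - exact: (comp_linear (lift2_linear _) (tens_linearl 1)).
  - exact: (comp_linear (tens_linearl 1) theta_linear).
  rewrite -forest_poly_nil -/(ften _ _) lift2_ften /scale !wE addn0.
  rewrite theta_forest (linZ (tens_linearl _)); reflexivity.
have scaler x : lift2 scale (tens 1 x) = tens 1 (theta x).
  move: x; apply: HR_lin_eq => [||s].
  - exact: (comp_linear (lift2_linear _) (tens_linearr 1)).
  - exact: (comp_linear (tens_linearr 1) theta_linear).
  rewrite -forest_poly_nil -/(ften _ _) lift2_ften /scale !wE add0n.
  rewrite theta_forest (linZ (tens_linearr _)); reflexivity.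
apply: eq_trans (Delta_theta p) _; rewrite prim_p.
apply: eq_trans (linD (lift2_linear scale) _ _) _.
exact (congr2 _ (scalel p) (scaler p)).
Qed.

(* For p = l_1 this is the 1-cocycle property of the operator B^+. *)
Lemma Delta_top x p : primitive p ->
  Delta (top x p) = tens (top x p) 1 + lift2 (fun a b => tens a (top b p)) (Delta x).
Proof.
move=> /theta_primitive prim_p; move: x; apply: HR_lin_eq => [||s].
- exact: comp_linear Delta_linear (top_linearl p).
- apply: addr_linear; last exact: comp_linear (lift2_linear _) Delta_linear.
  exact: (comp_linear (tens_linearl 1) (top_linearl p)).
rewrite lift2_Delta_forest topE Delta_graft_forest prim_p.
move: (theta p) (topE^~ p) => q topq.
(* As [graft x 1 = 0], only q (x) 1 survives in this part, and only 1 (x) q in the other one treated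
   below. *)
have cocyclel x : graft_cocyclel x (tens q 1 + tens 1 q) = tens (graft x q) 1.
  pose beta a b := tens (graft x a) b.
  have bl b : linear (beta^~ b).
    exact: (comp_linear (tens_linearl b) (graft_linearr x)).
  have br a : linear (beta a) by exact: tens_linearr.
  apply: (eq_trans (linD (lift2_linear beta) _ _)).
  apply: (eq_trans (congr2 _ (lift2_tens bl br q 1) (lift2_tens bl br 1 q))).
  rewrite /beta graft1 (lin0 (tens_linearl q)); exact: addr0.
refine (congr2 _ (cocyclel _) _); apply: eq_bigr => z _.
pose beta a b := tens (forest_poly z.1 * a) (graft (forest_poly z.2) b).
have bl b : linear (beta^~ b).
  exact: (comp_linear (tens_linearl _) (mulr_linear _)).
have br a : linear (beta a).
  exact: (comp_linear (tens_linearr _) (graft_linearr _)).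
apply: (eq_trans (linD (lift2_linear beta) _ _)).
apply: (eq_trans (congr2 _ (lift2_tens bl br q 1) (lift2_tens bl br 1 q))).
rewrite /beta graft1 topq.
apply: (eq_trans (congr2 _ (lin0 (tens_linearr _)) _) (add0r _)).
exact: (congr1 (tens^~ _) (mulr1 _)).
Qed.

(** * The element 1 as left argument of T *)

Lemma fgraft_nil s : fgraft [::] s = nseq (wt s) s.
Proof.
have step l : (forall t, t \in l -> graft_at [::] t = nseq (weight t) t) ->
    fgraft [::] l = nseq (wt l) l.
  elim: l => [|t l IH] Hl //=.
  rewrite (Hl t (mem_head _ _)) IH; last by move=> u ul; apply: Hl; rewrite inE ul orbT.
  by rewrite !map_nseq -nseqD.
apply: (step s) => t _; elim/tree_mem_ind: t => l IH.
by rewrite graft_at_Node cats0 (step l IH) map_nseq.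
Qed.

Lemma graftf_nil s : graftf [::] s = (wt s)%:R *: forest_poly s.
Proof.
rewrite /graftf fgraft_nil big_nseq scaler_nat.
elim: (wt s) => [|n IH]; first by rewrite mulr0n.
rewrite iterS IH mulrS; reflexivity.
Qed.

Lemma wt_eq0 s : (wt s == 0%N) = (s == [::]).
Proof. by case: s => [|t s] //; rewrite wt_cons addn_eq0 eqn0Ngt weight_gt0. Qed.

(** The counit followed by the inclusion of the scalars in [HR]. *)
Definition constpart : HR -> HR := linext (fun m : forest => (m == onecm CT)%:R).

Lemma constpart_linear : linear constpart.
Proof. exact: linext_is_linear. Qed.

Lemma constpart_forest s : constpart (forest_poly s) = (s == [::])%:R.
Proof. rewrite forest_polyE /constpart linextU mon_eq1; reflexivity. Qed.

Lemma sub_linear (U V : lmodType rat) (f g : U -> V) :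
  linear f -> linear g -> linear (fun x => f x - g x).
Proof. by move=> fl gl a x y; rewrite fl gl scalerBr opprD addrACA. Qed.

Lemma id_linear (V : lmodType rat) : linear (fun x : V => x).
Proof. by []. Qed.

Lemma top1x x : top 1 x = x - constpart x.
Proof.
rewrite topE -forest_poly_nil; move: x; apply: HR_lin_eq => [||s].
- exact: comp_linear (graft_linearr _) theta_linear.
- exact: sub_linear (@id_linear HR) constpart_linear.
rewrite theta_forest (linZ (graft_linearr _)) graft_forest graftf_nil scalerA.
rewrite constpart_forest; have [->|s_neq0] := eqVneq s [::].
  by rewrite mulr0 scale0r forest_poly_nil; symmetry; exact: subrr.
have wt_neq0 : (wt s)%:R != 0 :> rat by rewrite Num.Theory.pnatr_eq0 wt_eq0.
rewrite (mulVf wt_neq0) scale1r; symmetry; exact: subr0.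
Qed.

(** Apply counit (x) id to Delta p: the counit axiom gives p on one side, primitivity gives
    [constpart p + p] on the other. *)
Lemma constpart_primitive p : primitive p -> constpart p = 0.
Proof.
move=> prim_p; pose beta a b := constpart a * b.
have bl b : linear (beta^~ b).
  by move=> a x y; rewrite /beta constpart_linear; apply: scaleDMl.
have br a : linear (beta a) by exact: mulr_linear.
have counit_l x : lift2 beta (Delta x) = x.
  move: x; apply: HR_lin_eq => [||s].
  - exact: comp_linear (lift2_linear _) Delta_linear.
  - exact: id_linear.
  rewrite lift2_Delta_forest.
  rewrite (sum_fcuts_empty (fun a b => beta (forest_poly a) (forest_poly b))).
  rewrite /beta constpart_forest eqxx big1 => [|w /negPf w0]; last first.
    rewrite constpart_forest w0; exact: mul0r.
  apply: (eq_trans (addr0 _)); exact: mul1r.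
have := counit_l p; rewrite prim_p => /(eq_trans (esym (linD (lift2_linear beta) _ _))).
move/(eq_trans (esym (congr2 _ (lift2_tens bl br p 1) (lift2_tens bl br 1 p)))).
have -> : beta 1 p = p.
  rewrite /beta -forest_poly_nil constpart_forest; exact: mul1r.
have -> : beta p 1 = constpart p by exact: mulr1.
move/(congr1 (fun z => z - p)) => E.
by apply: eq_trans (esym (addrK p _)) (eq_trans E (subrr p)).
Qed.

Lemma top1_primitive p : primitive p -> top 1 p = p.
Proof. by move=> /constpart_primitive E; rewrite top1x E; apply: subr0. Qed.

(** * The recursive equation of Phi on arbitrary representatives *)

(** Injectivity of B^+. *)
Lemma mon_children s s' : cl (Node s) = cl (Node s') -> mon s = mon s'.
Proof.
move=> /clP/canon_Node/(perm_map cl) E; apply/monP.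
have clE l : map cl l = map cl (map canon l).
  by rewrite -map_comp; apply: eq_map => u /=; rewrite cl_canon.
by rewrite clE (clE s').
Qed.

Lemma sum_cuts_mon (V : nmodType) (G : forest -> CT -> V) t t' : cl t = cl t' ->
  \sum_(c <- cuts t | c.1 != [::]) G (mon c.1) (cl c.2) =
  \sum_(c <- cuts t' | c.1 != [::]) G (mon c.1) (cl c.2).
Proof.
case: t t' => s [s'] /mon_children E.
(* The condition that the cut is nonempty moves into the summand as a condition on [mon w.1], so
   that [sum_fcuts_mon] applies. *)
have cutsE l : \sum_(c <- cuts (Node l) | c.1 != [::]) G (mon c.1) (cl c.2) =
    \sum_(w <- fcuts l)
      (if mon w.1 == onecm CT then 0 else G (mon w.1) (Bplus (mon w.2))).
  rewrite cuts_Node big_map big_mkcond /=; apply: eq_bigr => w _.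
  by rewrite mon_eq1 cl_NodeE; case: (w.1 == [::]).
rewrite !cutsE.
exact: (sum_fcuts_mon (fun m n => if m == onecm CT then 0 else G m (Bplus n)) E).
Qed.

Lemma eq_sum_mem (V : nmodType) (I : eqType) (r : seq I) (P : pred I) (F G : I -> V) :
    (forall i, i \in r -> P i -> F i = G i) ->
  \sum_(i <- r | P i) F i = \sum_(i <- r | P i) G i.
Proof.
move=> E; rewrite big_seq_cond [RHS]big_seq_cond.
by apply: eq_bigr => i /andP[]; apply: E.
Qed.

Lemma eq_prod_mem (A : comAlgType rat) (I : eqType) (r : seq I) (F G : I -> A) :
  (forall i, i \in r -> F i = G i) -> \prod_(i <- r) F i = \prod_(i <- r) G i.
Proof. by move=> E; rewrite big_seq [RHS]big_seq; apply: eq_bigr. Qed.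

Lemma weight_cut_trunk t c : c \in cuts t -> c.1 != [::] -> (weight c.2 < weight t)%N.
Proof.
move=> /weight_cuts <-; rewrite -wt_eq0 -lt0n => c1_gt0.
by rewrite -[X in (X < _)%N]add0n ltn_add2r.
Qed.

Lemma weight_cut_branch t c u : c \in cuts t -> u \in c.1 -> (weight u < weight t)%N.
Proof.
move=> /weight_cuts <- /weight_mem /leq_ltn_trans; apply.
by rewrite -[X in (X < _)%N]addn0 ltn_add2l weight_gt0.
Qed.

Lemma Phi_linear P : linear (Phi P).
Proof. move=> a x y; exact: alg_ext_linear. Qed.

Lemma Phi_forest P s : Phi P (forest_poly s) = \prod_(u <- s) Phi_tree P (cl u).
Proof. exact: alg_ext_forest. Qed.

(** Taken with [f := Phi P] in the recursion for Phi, and with [f := Psi] when that recursion is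
    solved for [P]. *)
Definition cut_sum (f : HR -> HR) (P : CT -> HR) (t : tree) : HR :=
  \sum_(c <- cuts t | c.1 != [::]) top (f (forest_poly c.1)) (P (cl c.2)).

Lemma cut_sum_mon f P t t' : cl t = cl t' -> cut_sum f P t = cut_sum f P t'.
Proof.
move=> E; have F := sum_cuts_mon (fun m T => top (f << m >>) (P T)) E.
rewrite /cut_sum; etransitivity; last (etransitivity; first exact: F).
  by apply: eq_bigr => c _; rewrite forest_polyE; reflexivity.
by apply: eq_bigr => c _; rewrite forest_polyE; reflexivity.
Qed.

Lemma Phi_fuelS P n t : Phi_fuel P n.+1 t =
  \sum_(c <- cuts t | c.1 != [::])
     top (\prod_(u <- c.1) Phi_fuel P n u) (P (cl c.2)) + P (cl t).
Proof. reflexivity. Qed.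

Lemma Phi_fuelE P n t : (weight t <= n)%N -> Phi_fuel P n t = Phi_tree P (cl t).
Proof.
have [k] := ubnP (weight t); elim: k t n => // k IH t n; rewrite ltnS => tk tn.
(* Stated for all such [r] since it serves both [t] and the representative [repr (cl t)], which may
   be different trees. *)
have step r m : (weight r <= k)%N -> (weight r <= m)%N ->
    Phi_fuel P m r = cut_sum (Phi P) P r + P (cl r).
  case: m => [|m] rk; first by rewrite leqNgt weight_gt0.
  move=> rm; rewrite Phi_fuelS; apply: (f_equal (+%R^~ (P (cl r)))).
  rewrite /cut_sum; apply: eq_sum_mem => c cr _; rewrite Phi_forest; congr top.
  apply: eq_prod_mem => u /(weight_cut_branch cr) ur; apply: IH.
    exact: leq_trans ur rk.
  by rewrite -ltnS (leq_trans ur rm).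
rewrite /Phi_tree (step t n tk tn) (step (repr (cl t))) ?weight_repr ?cl_repr //.
apply: (f_equal (+%R^~ (P (cl t)))); apply: cut_sum_mon; rewrite cl_repr; reflexivity.
Qed.

Lemma Phi_treeE P t : Phi_tree P (cl t) = cut_sum (Phi P) P t + P (cl t).
Proof.
rewrite -(Phi_fuelE P (leqnn (weight t))); case E: (weight t) => [|n].
  by have := weight_gt0 t; rewrite E.
rewrite Phi_fuelS; apply: (f_equal (+%R^~ (P (cl t)))).
rewrite /cut_sum; apply: eq_sum_mem => c ct _; rewrite Phi_forest; congr top.
apply: eq_prod_mem => u /(weight_cut_branch ct); rewrite E ltnS.
exact: Phi_fuelE.
Qed.

(** * The family determined by Psi *)

Section PrimitivePart.
Variable Psi : {lrmorphism HR -> HR}.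

(** The recursion goes to trunks, which are not subterms, hence the fuel; the weight is enough fuel
    because the trunk of a nonempty cut is strictly lighter. *)
Fixpoint prim_part_fuel (n : nat) (t : tree) : HR :=
  if n is n'.+1 then
    Psi (X (cl t)) -
    \sum_(c <- cuts t | c.1 != [::]) top (Psi (forest_poly c.1)) (prim_part_fuel n' c.2)
  else 0.

Definition prim_part (T : CT) : HR := prim_part_fuel (weight (repr T)) (repr T).

Lemma prim_part_fuelE n t : (weight t <= n)%N ->
  prim_part_fuel n t = Psi (X (cl t)) - cut_sum Psi prim_part t.
Proof.
have [k] := ubnP (weight t); elim: k t n => // k IH t [|n]; rewrite ltnS => tk tn.
  by move: tn; rewrite leqNgt weight_gt0.
rewrite /=; refine (congr1 _ _); refine (congr1 _ _).
rewrite /cut_sum; apply: eq_sum_mem => c ct c0; congr top.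
have cw := weight_cut_trunk ct c0.
rewrite IH; last 2 first.
- exact: leq_trans cw tk.
- by rewrite -ltnS (leq_trans cw tn).
rewrite /prim_part IH ?weight_repr ?cl_repr //; last exact: leq_trans cw tk.
refine (congr1 _ _); refine (congr1 _ _).
apply: cut_sum_mon; rewrite cl_repr; reflexivity.
Qed.

Lemma prim_partE t : prim_part (cl t) = Psi (X (cl t)) - cut_sum Psi prim_part t.
Proof.
rewrite /prim_part prim_part_fuelE // cl_repr; refine (congr1 _ _); refine (congr1 _ _).
apply: cut_sum_mon; rewrite cl_repr; reflexivity.
Qed.

Lemma Psi_linear : linear Psi.
Proof. exact: linearP. Qed.

Lemma Psi_forest s : Psi (forest_poly s) = \prod_(u <- s) Psi (X (cl u)).
Proof. exact: rmorph_prod. Qed.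

(** Phi has left the right-hand side. Both maps are linear and multiplicative, so trees suffice, and
    by induction [Psi] may replace [Phi P] on the pruned trees, which are lighter. The result is an
    equation to be solved for [P]. *)
Lemma Psi_Phi P : Psi =1 Phi P <->
  forall t, Psi (X (cl t)) = cut_sum Psi P t + P (cl t).
Proof.
have cut_sumE (t : tree) : (forall c, c \in cuts t ->
      Psi (forest_poly c.1) = Phi P (forest_poly c.1)) ->
    cut_sum Psi P t = cut_sum (Phi P) P t.
  move=> E; rewrite /cut_sum; apply: eq_sum_mem => c ct _.
  by rewrite (E c ct).
split=> [E t|E].
  rewrite cut_sumE => [|c _]; last exact: E.
  rewrite -Phi_treeE -forest_poly1 E Phi_forest; exact: big_seq1.
apply: HR_lin_eq => [||s]; [exact: Psi_linear | exact: Phi_linear |].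
rewrite Psi_forest Phi_forest; apply: eq_bigr => t _.
have [k] := ubnP (weight t); elim: k t => // k IH t; rewrite ltnS => tk.
rewrite E Phi_treeE cut_sumE // => c ct; rewrite Psi_forest Phi_forest.
apply: eq_prod_mem => u /(weight_cut_branch ct) ut.
by apply: IH; apply: leq_trans ut tk.
Qed.

End PrimitivePart.

(** * Primitivity of that family *)

Lemma addr_cancel (W : zmodType) (a b c d : W) : a + b = a + c + d -> b = c + d.
Proof. by rewrite -addrA => /addrI. Qed.

Lemma addr_sub_cancel (W : zmodType) (a b c d r : W) :
  a + (b + r) - (c + (d + r)) = (a - c) + (b - d).
Proof. by rewrite (addrA a) (addrA c) opprD addrACA subrr addr0 opprD addrACA. Qed.

Lemma addrCAr (W : zmodType) (a b : W) : b + (a - b) = a.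
Proof. by rewrite addrCA subrr addr0. Qed.

Lemma addrAC_sub (W : zmodType) (a b : W) : a + b - a = b.
Proof. by rewrite addrAC subrr add0r. Qed.

Lemma tens_map_sum_ften (f g : HR -> HR) (r : seq (seq tree * seq tree)) :
  tens_map f g (\sum_(w <- r) ften w.1 w.2) =
  \sum_(w <- r) tens (f (forest_poly w.1)) (g (forest_poly w.2)).
Proof.
pose beta a b := tens (f a) (g b).
(* [tens_map f g] is [lift2 beta] by conversion. *)
apply: (eq_trans (lin_sum (lift2_linear beta) _ _ _)).
by apply: eq_bigr => w _; apply: (lift2_ften beta).
Qed.

Section PrimPartPrimitive.
Variable Psi : {lrmorphism HR -> HR}.
Hypothesis Psi_Delta : forall x, Delta (Psi x) = tens_map Psi Psi (Delta x).

Lemma Delta_Psi_forest s : Delta (Psi (forest_poly s)) =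
  \sum_(w <- fcuts s) tens (Psi (forest_poly w.1)) (Psi (forest_poly w.2)).
Proof. rewrite Psi_Delta Delta_forest; exact: tens_map_sum_ften. Qed.

Lemma Delta_top_Psi s p : primitive p ->
  Delta (top (Psi (forest_poly s)) p) = tens (top (Psi (forest_poly s)) p) 1 +
  \sum_(w <- fcuts s)
    tens (Psi (forest_poly w.1)) (top (Psi (forest_poly w.2)) p).
Proof.
move=> prim_p; rewrite (Delta_top _ prim_p) Delta_Psi_forest.
pose beta a b := tens a (top b p).
have bl b : linear (beta^~ b) by exact: tens_linearl.
have br a : linear (beta a) by exact: (comp_linear (tens_linearr a) (top_linearl p)).
apply: (f_equal (+%R (tens (top (Psi (forest_poly s)) p) 1))).
apply: (eq_trans (lin_sum (lift2_linear beta) _ _ _)).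
by apply: eq_bigr => w _; apply: (lift2_tens bl br).
Qed.

Lemma Psi1 : Psi (forest_poly [::]) = 1.
Proof. rewrite forest_poly_nil; exact: rmorph1. Qed.

(** With x = Psi t and S the correction, Delta x and Delta S have the same mixed part [R], which
    disappears from p = x - S. *)
Lemma prim_part_primitive_step s :
    (forall t, (weight t < weight (Node s))%N -> primitive (prim_part Psi (cl t))) ->
  primitive (prim_part Psi (cl (Node s))).
Proof.
move=> IH.
pose psi a := Psi (forest_poly a); pose p b := prim_part Psi (cl (Node b)).
pose x b := Psi (X (cl (Node b))).
pose S := \sum_(w <- fcuts s | w.1 != [::]) top (psi w.1) (p w.2).
pose R := \sum_(w <- fcuts s | w.1 != [::]) tens (psi w.1) (x w.2).
pose g a b c := tens (psi a) (top (psi b) (p c)).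
have psi_nil : psi [::] = 1 by exact: Psi1.
have cut_sumE b : cut_sum Psi (prim_part Psi) (Node b) =
    \sum_(w <- fcuts b | w.1 != [::]) top (psi w.1) (p w.2).
  rewrite /cut_sum cuts_Node; exact: big_map.
have xE b : x b = \sum_(w <- fcuts b | w.1 != [::]) top (psi w.1) (p w.2) + p b.
  apply: (eq_trans _ (f_equal2 +%R (cut_sumE b) (esym (prim_partE Psi (Node b))))).
  by symmetry; apply: addrCAr.
have p_prim w : w \in fcuts s -> w.1 != [::] -> primitive (p w.2).
  move=> ws w0; apply: (IH (Node w.2)); apply: (@weight_cut_trunk _ (w.1, Node w.2)) => //.
  by rewrite cuts_Node; apply/mapP; exists w.
(* Only for proper trunks, whose [p w.2] is already primitive and so equals [top 1 (p w.2)]. *)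
have x_full w : w \in fcuts s -> w.1 != [::] ->
    x w.2 = \sum_(z <- fcuts w.2) top (psi z.1) (p z.2).
  move=> ws w0; rewrite xE (sum_fcuts_empty (fun a b => top (psi a) (p b))).
  rewrite psi_nil (top1_primitive (p_prim w ws w0)); exact: addrC.
have Delta_x : Delta (x s) = tens (x s) 1 + (tens 1 (x s) + R).
  rewrite {1}/x -forest_poly1 Delta_Psi_forest.
  rewrite (sum_fcuts1 (fun a b => tens (psi a) (psi b))).
  rewrite (sum_tcuts_Node (fun a b => tens (psi a) (psi b))).
  rewrite (sum_fcuts_empty (fun a b => tens (psi a) (psi [:: Node b]))) psi_nil.
  have psi1 b : psi [:: Node b] = x b by rewrite /psi forest_poly1.
  rewrite !psi1 /R; refine (f_equal2 _ erefl (f_equal2 _ erefl _)).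
  by apply: eq_bigr => w _; rewrite psi1.
have Delta_S : Delta S = tens S 1 + (tens 1 S + R).
  rewrite /S (lin_sum Delta_linear) tens_suml tens_sumr.
  transitivity (\sum_(w <- fcuts s | w.1 != [::]) (tens (top (psi w.1) (p w.2)) 1 +
      \sum_(z <- fcuts w.1) g z.1 z.2 w.2)).
    by apply: eq_sum_mem => w ws w0; apply: Delta_top_Psi; apply: p_prim.
  rewrite big_split; apply: (f_equal2 _ erefl).
  (* Split off the empty outer cut on both sides, and on the right the empty inner one too. The
     common term [g [::] [::] s], the only one that contains [p s], cancels; the rest of the
     right-hand side is 1 (x) S plus [R]. *)
  have nested := sum_nested_fcuts g s.
  have lhsE := sum_fcuts_empty (fun a b => \sum_(z <- fcuts a) g z.1 z.2 b) s.
  have rhsE := sum_fcuts_empty (fun a b => \sum_(z <- fcuts b) g a z.1 z.2) s.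
  have nilE := sum_fcuts_nil (fun a b => g a b s).
  have emptyE := sum_fcuts_empty (g [::]) s.
  have {}nested := eq_trans (esym lhsE) (eq_trans nested rhsE).
  have {}nested := eq_trans (f_equal (+%R^~ _) (esym nilE)) nested.
  have {}nested := eq_trans nested (f_equal (+%R^~ _) emptyE).
  apply: (eq_trans (addr_cancel nested)); apply: f_equal2.
    by apply: eq_bigr => w _; exact (f_equal (tens^~ _) psi_nil).
  apply: eq_sum_mem => w ws w0; rewrite (x_full w ws w0) tens_sumr; reflexivity.
have pE : p s = x s - S by rewrite /S -cut_sumE; apply: prim_partE.
rewrite -/(p s) pE /primitive; apply: (eq_trans (linB Delta_linear _ _)).
apply: (eq_trans (f_equal2 (fun a b => a - b) Delta_x Delta_S)).
apply: (eq_trans (addr_sub_cancel _ _ _ _ _)); symmetry.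
exact: (f_equal2 +%R (linB (tens_linearl 1) _ _) (linB (tens_linearr 1) _ _)).
Qed.

Lemma prim_part_primitive T : primitive (prim_part Psi T).
Proof.
rewrite -(cl_repr T); move: (repr T) => t.
have [k] := ubnP (weight t); elim: k t => // k IH [s]; rewrite ltnS => sk.
by apply: prim_part_primitive_step => t ts; apply: IH; apply: leq_trans ts sk.
Qed.

End PrimPartPrimitive.

(** * Existence and uniqueness *)

Theorem theorem10p2 (Psi : {lrmorphism HR -> HR}) :
  bialg_endo Psi ->
  exists P : CT -> HR,
    ((forall T, primitive (P T)) /\ Psi =1 Phi P) /\
    (forall P' : CT -> HR,
        (forall T, primitive (P' T)) /\ Psi =1 Phi P' -> P' =1 P).
Proof.
move=> [Psi_Delta _]; exists (prim_part Psi); split=> [|P' [_ /Psi_Phi E]].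
  split; first exact: prim_part_primitive.
  apply/Psi_Phi => t; rewrite prim_partE; symmetry; exact: addrCAr.
move=> T; rewrite -(cl_repr T); move: (repr T) => t.
have [k] := ubnP (weight t); elim: k t => // k IH t; rewrite ltnS => tk.
have cut_sumE : cut_sum Psi P' t = cut_sum Psi (prim_part Psi) t.
  apply: eq_sum_mem => c ct c0; apply: (f_equal (top _)); apply: IH.
  exact: leq_trans (weight_cut_trunk ct c0) tk.
rewrite prim_partE E -cut_sumE; symmetry; exact: addrAC_sub.
Qed.
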